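(* Let $(V,Y,\mathbf 1,\omega)$ be a vertex operator algebra. The product $\bullet$ in $V$ induces a product (denoted still by $\bullet$) in $\tilde A(V)=V/\tilde O(V)$ such that $\tilde A(V)$ together with this product and the equivalence class of the vacuum $\mathbf 1\in V$ is an associative algebra with identity. Moreover, for any $u,v\in V$, $(L(-1)u)\bullet v\in\tilde O(V)$ and $u\bullet v\equiv v\bullet u-2\pi i\,v_0u\mod\tilde O(V)$. In particular, $\omega+\tilde O(V)$ is in the center of $\tilde A(V)$.
   Context: $Y(u,x)=\sum_{n\in\mathbb{Z}}u_nx^{-n-1}$ and $Y(\omega,x)=\sum_nL(n)x^{-n-2}$. $\operatorname{Res}_x$ denotes the coefficient of $x^{-1}$. For $u,v\in V$, $$u\bullet v=\operatorname{Res}_yy^{-1}Y\left(u,\frac1{2\pi i}\log(1+y)\right)v=\operatorname{Res}_x\frac{2\pi ie^{2\pi ix}}{e^{2\pi ix}-1}Y(u,x)v.$$ $\tilde O(V)$ is the subspace of $V$ spanned by the elements $$\operatorname{Res}_yy^{-n}Y\left(u,\frac1{2\pi i}\log(1+y)\right)v=\operatorname{Res}_x\frac{2\pi ie^{2\pi ix}}{(e^{2\pi ix}-1)^n}Y(u,x)v$$ for $n>1$ and $u,v\in V$. *)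

(* Defs.v *)
From HB Require Import structures.
From mathcomp Require Import all_boot all_order all_algebra.
From mathcomp Require Import boolp classical_sets cardinality fsbigop reals trigo.
From mathcomp Require Import complex.

Set Implicit Arguments.
Unset Strict Implicit.
Unset Printing Implicit Defensive.

Import Order.TTheory GRing.Theory Num.Theory.
Local Open Scope classical_set_scope.
Local Open Scope quotient_scope.
Local Open Scope ring_scope.

Section Span.
Variables (K : fieldType) (V : lmodType K).

Definition lspan (S : set V) : {pred V} := fun w =>
  `[< exists (n : nat) (c : 'I_n -> K) (g : 'I_n -> V),
      (forall i, S (g i)) /\ w = \sum_(i < n) c i *: g i >].

Lemma lspan_submod_closed (S : set V) : GRing.submod_closed (lspan S).
Proof.
split.
  apply/asboolP; exists 0%N, (fun=> 0), (fun=> 0).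
  by split; [case|rewrite big_ord0].
move=> a u v /asboolP[m [c [g [Sg ->]]]] /asboolP[n [d [h [Sh ->]]]].
apply/asboolP; exists (m + n)%N.
exists (fun i => match fintype.split i with inl j => a * c j | inr j => d j end).
exists (fun i => match fintype.split i with inl j => g j | inr j => h j end).
split; first by move=> i; case: (fintype.split i).
rewrite big_split_ord /= scaler_sumr; congr (_ + _); apply: eq_bigr => i _.
  by rewrite (unsplitK (inl _ i)) scalerA.
by rewrite (unsplitK (inr _ i)).
Qed.

HB.instance Definition _ (S : set V) :=
  GRing.isSubmodClosed.Build K V (lspan S) (lspan_submod_closed S).

End Span.

(* [Quotient.quot] expects a [zmodClosed], which is not inherited by
   [submodClosed] in the library, and only yields an additive group. *)
Section LmodQuotient.
Variables (K : fieldType) (V : lmodType K) (W : submodClosed V).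

Definition submod_pred : {pred V} := fun v => v \in W.

Fact submod_zmod_closed : zmod_closed submod_pred.
Proof.
have [W0 WD] := GRing.submodClosedP W; split=> // u v uW vW.
by rewrite addrC -scaleN1r; apply: WD.
Qed.

HB.instance Definition _ :=
  GRing.isZmodClosed.Build V submod_pred submod_zmod_closed.

Definition lquot := Quotient.quot submod_pred.

HB.instance Definition _ := GRing.Zmodule.on lquot.

Definition lquot_pi : V -> lquot := \pi_lquot.

Definition lquot_scale (a : K) : lquot -> lquot := lift_op1 lquot ( *:%R a ).

Lemma lquot_pi_scale a :
  {morph lquot_pi : x / a *: x >-> lquot_scale a x}.
Proof.
move=> x; rewrite /lquot_pi; unlock lquot_scale; apply/eqP.
rewrite -Quotient.idealrBE -scalerBr.
have : x - repr (\pi_lquot x) \in submod_pred by rewrite Quotient.idealrBE reprK.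
exact: rpredZ.
Qed.

Lemma lquot_eqP x y : lquot_pi x = lquot_pi y <-> x - y \in W.
Proof.
rewrite (_ : (x - y \in W) = (x - y \in submod_pred)) // Quotient.idealrBE.
by split=> [/eqP|/eqP].
Qed.

Fact lquot_piD : {morph lquot_pi : x y / x + y}.
Proof. exact: raddfD. Qed.

Fact lquot_ind (P : lquot -> Prop) : (forall x, P (lquot_pi x)) -> forall v, P v.
Proof. by move=> Ppi v; rewrite -[v]reprK; apply: Ppi. Qed.

Fact lquot_scaleA a b v :
  lquot_scale a (lquot_scale b v) = lquot_scale (a * b) v.
Proof. by elim/lquot_ind: v => v; rewrite -!lquot_pi_scale scalerA. Qed.

Fact lquot_scale1 : left_id 1 lquot_scale.
Proof. by elim/lquot_ind => v; rewrite -lquot_pi_scale scale1r. Qed.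

Fact lquot_scaleDr : right_distributive lquot_scale +%R.
Proof.
move=> a; elim/lquot_ind => u; elim/lquot_ind => v.
by rewrite -lquot_piD -!lquot_pi_scale scalerDr lquot_piD.
Qed.

Fact lquot_scaleDl v : {morph lquot_scale^~ v : a b / a + b}.
Proof.
elim/lquot_ind: v => v a b.
by rewrite -!lquot_pi_scale scalerDl lquot_piD.
Qed.

HB.instance Definition _ := GRing.Zmodule_isLmodule.Build K lquot
  lquot_scaleA lquot_scale1 lquot_scaleDr lquot_scaleDl.

End LmodQuotient.

(* m (m - 1) ... (m - i + 1) / i! for an arbitrary integer m *)
Definition binz (K : fieldType) (m : int) (i : nat) : K :=
  (\prod_(j < i) (m - j%:Z)%:~R) / i`!%:R.

(* A formal Laurent series in y is represented by its coefficient function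
   [int -> T], and a power series by its coefficient function [nat -> T]. *)
Section FormalSeries.
Variable K : fieldType.

Definition ps_mul (a b : nat -> K) (n : nat) : K :=
  \sum_(i < n.+1) a i * b (n - i)%N.

Definition ps_exp (a : nat -> K) (j : nat) : nat -> K :=
  iter j (ps_mul a) (fun n => (n == 0%N)%:R).

(* a ^ m for m in Z and a power series a with constant term 1, by the
   binomial expansion of (1 + (a - 1)) ^ m; the terms j > n do not contribute
   to the coefficient of y ^ n. *)
Definition ps_expz (a : nat -> K) (m : int) (n : nat) : K :=
  \sum_(j < n.+1) binz K m j * ps_exp (fun k => a k - (k == 0%N)%:R) j n.

(* y^-1 log(1 + y) *)
Definition log1p_div (k : nat) : K := (-1) ^+ k / k.+1%:R.

(* log(1 + y) ^ m = y ^ m (y^-1 log(1 + y)) ^ m, in K((y)) *)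
Definition log1p_expz (m j : int) : K :=
  if j - m is Posz n then ps_expz log1p_div m n else 0.

Definition mul_yX (T : Type) (m : int) (f : int -> T) : int -> T :=
  fun j => f (j - m).

Definition Res (T : Type) (f : int -> T) : T := f (-1).

End FormalSeries.

(* Y is given by its modes: [voa_mode u n v] is u_n v, the coefficient of
   x^(-n-1) in Y(u, x)v.  The sums over [setT] are finitely supported, by
   [voa_trunc]. *)
Record VOA (R : realType) := MkVOA {
  voa_space :> lmodType R[i];
  voa_mode : voa_space -> int -> voa_space -> voa_space;
  voa_vac : voa_space;
  voa_omega : voa_space;
  voa_rank : R[i];
  voa_gr : int -> submodClosed voa_space;

  voa_linear_l : forall n v, linear (fun u => voa_mode u n v);
  voa_linear_r : forall u n, linear (voa_mode u n);

  voa_gr_direct : forall v, exists! f : int -> voa_space,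
    [/\ forall n, f n \in voa_gr n,
        finite_set [set n | f n != 0]
      & v = \sum_(n \in [set: int]) f n];
  voa_gr_findim : forall n, exists s : seq voa_space,
    {subset voa_gr n <= lspan [set` s]};
  voa_gr_lower : exists N : int, forall n : int, n < N ->
    forall v, v \in voa_gr n -> v = 0;

  voa_trunc : forall u v, exists N : int, forall n : int, N <= n ->
    voa_mode u n v = 0;

  voa_vac_gr : voa_vac \in voa_gr 0;
  voa_vacuum : forall n v,
    voa_mode voa_vac n v = if n == -1 then v else 0;
  voa_creation : forall v, voa_mode v (-1) voa_vac = v;
  voa_creation_reg : forall v (n : int), 0 <= n -> voa_mode v n voa_vac = 0;

  (* Jacobi identity
       x0^-1 delta((x1 - x2) / x0) Y(u, x1) Y(v, x2) w
       - x0^-1 delta((x2 - x1) / (- x0)) Y(v, x2) Y(u, x1) w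
       = x2^-1 delta((x1 - x0) / x2) Y(Y(u, x0) v, x2) w:
     coefficient of x0^(-l-1) x1^(-m-1) x2^(-n-1) *)
  voa_jacobi : forall u v w (l m n : int),
    \sum_(i \in [set: nat]) (((-1) ^+ i * binz R[i] l i) *:
       voa_mode u (m + l - i%:Z) (voa_mode v (n + i%:Z) w))
    - \sum_(i \in [set: nat]) (((-1) ^ l * (-1) ^+ i * binz R[i] l i) *:
       voa_mode v (n + l - i%:Z) (voa_mode u (m + i%:Z) w))
    = \sum_(i \in [set: nat]) (binz R[i] m i *:
       voa_mode (voa_mode u (l + i%:Z) v) (m + n - i%:Z) w);

  (* Virasoro relations, with L(n) = omega_(n+1) *)
  voa_omega_gr : voa_omega \in voa_gr 2;
  voa_virasoro : forall (m n : int) v,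
    voa_mode voa_omega (m + 1) (voa_mode voa_omega (n + 1) v)
    - voa_mode voa_omega (n + 1) (voa_mode voa_omega (m + 1) v)
    = (m - n)%:~R *: voa_mode voa_omega (m + n + 1) v
      + (if m + n == 0 then (m ^+ 3 - m)%:~R / 12%:R * voa_rank else 0) *: v;
  voa_L0 : forall n v, v \in voa_gr n ->
    voa_mode voa_omega (0 + 1) v = n%:~R *: v;
  (* d/dx Y(v, x) = Y(L(-1)v, x) *)
  voa_derivative : forall v n w,
    voa_mode (voa_mode voa_omega (-1 + 1) v) n w = - n%:~R *: voa_mode v (n - 1) w
}.

Section ATilde.
Variables (R : realType) (V : VOA R).
Implicit Types u v : V.

Definition voa_L (n : int) (v : V) : V := voa_mode (voa_omega V) (n + 1) v.

Definition twopii : R[i] := ((2 * pi)%:C * 'i)%C.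

(* Y(u, log(1 + y) / (2 pi i)) v in V((y)) *)
Definition Ylog u v : int -> V := fun j =>
  \sum_(n \in [set: int])
    ((twopii^-1 ^ (- n - 1) * log1p_expz R[i] (- n - 1) j) *: voa_mode u n v).

Definition bullet u v : V := Res (mul_yX (-1) (Ylog u v)).

Definition Otilde : submodClosed V :=
  lspan [set w : V | exists (n : int) u v,
    1 < n /\ w = Res (mul_yX (- n) (Ylog u v))].

Definition Atilde : lmodType R[i] := lquot Otilde.

Definition Aclass (v : V) : Atilde := lquot_pi Otilde v.

End ATilde.

Arguments twopii {R}.

(* Main.v *)
From HB Require Import structures.
Require Import Defs.
From mathcomp Require Import all_boot all_order all_algebra.
From mathcomp Require Import ring zify.
From mathcomp Require Import boolp functions classical_sets cardinality fsbigop reals trigo.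
From mathcomp Require Import complex.

(* In the coordinate x, the residue defining the product is Res_x phi(x) Y(u, x)v
   with phi = c e^(cx) / (e^(cx) - 1), c = 2 pi i, and everything rests on three
   properties of phi: the Riccati equation phi^2 = c phi - phi', the parity
   phi(-x) = c - phi(x), and the fact that the kernels c e^(cx) / (e^(cx) - 1)^n,
   n > 1, lie in the span of the derivatives of phi. Integrating by parts, the last
   one says that O~(V) is spanned by the (L(-1)u) . v; taking v = 1, it contains
   L(-1)V. Skew symmetry holds modulo L(-1)V and, with the parity of phi, it gives
   the commutator formula. For associativity, the Jacobi identity writes (u . v) . w
   as u . (v . w), plus residues against phi^(i), i > 0, minus residues against
   phi(x) phi^(i)(-x), i >= 0. By the Riccati equation all these kernels are
   derivatives of polynomials in phi, so that the residues lie in O~(V). Hence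
   O~(V) is an ideal, since it is spanned by products with left factor in L(-1)V. *)

Set Implicit Arguments.
Unset Strict Implicit.
Unset Printing Implicit Defensive.

Import Order.TTheory GRing.Theory Num.Theory.
Local Open Scope ring_scope.

(** * The ring of formal power series *)

Definition series (K : Type) := nat -> K.

Section SeriesRing.
Variable K : fieldType.
Implicit Types a b d : series K.

(** Only the additive structure of functions is copied to the alias [series]: its product is the
    Cauchy product, not the pointwise one. *)
HB.instance Definition _ := GRing.Zmodule.copy (series K) (nat -> K).

Definition trunc_poly (N : nat) a : {poly K} := \poly_(i < N) a i.

(** A coefficient of a product only sees finitely many coefficients of the factors, so the ring
    axioms reduce to those of polynomials. *)
Lemma ps_mul_poly a b N n : (n < N)%N ->
  ps_mul a b n = (trunc_poly N a * trunc_poly N b)`_n.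
Proof.
move=> nN; rewrite coefM; apply: eq_bigr => i _.
rewrite !coef_poly (leq_ltn_trans _ nN) ?leq_ord //.
by rewrite (leq_ltn_trans (leq_subr _ _)).
Qed.

Fact ps_mulA : associative (@ps_mul K).
Proof.
move=> a b d; apply/funext=> n.
pose P := trunc_poly n.+1.
have trunc_lt e (i : nat) : (i < n.+1)%N -> e i = (P e)`_i by rewrite coef_poly => ->.
transitivity ((P a * (P b * P d))`_n).
  rewrite coefM; apply: eq_bigr => i _; congr (_ * _); first exact: trunc_lt.
  by rewrite (ps_mul_poly _ _ (N := n.+1)) // ltnS leq_subr.
rewrite mulrA coefM; apply: eq_bigr => i _; congr (_ * _).
  by rewrite (ps_mul_poly _ _ (N := n.+1)).
by rewrite -trunc_lt // ltnS leq_subr.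
Qed.

Fact ps_mulC : commutative (@ps_mul K).
Proof.
by move=> a b; apply/funext=> n; rewrite !(ps_mul_poly _ _ (ltnSn n)) mulrC.
Qed.

Definition ps_one : series K := fun n => (n == 0%N)%:R.

Fact ps_mul1 : left_id ps_one (@ps_mul K).
Proof.
move=> a; apply/funext=> n.
rewrite /ps_mul big_ord_recl big1 ?addr0 /ps_one /= ?subn0 ?mul1r //.
by move=> i _; rewrite mul0r.
Qed.

Fact ps_mulDl : left_distributive (@ps_mul K) +%R.
Proof.
move=> a b d; apply/funext=> n; rewrite /= /ps_mul.
rewrite [RHS]/GRing.add /= -big_split; apply: eq_bigr => i _ /=.
by rewrite -mulrDl.
Qed.

Fact ps_one_neq0 : ps_one != 0.
Proof. by apply/eqP => /(congr1 (@^~ 0%N))/eqP; rewrite oner_eq0. Qed.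

HB.instance Definition _ := GRing.Zmodule_isComNzRing.Build (series K)
  ps_mulA ps_mulC ps_mul1 ps_mulDl ps_one_neq0.

Lemma psD a b n : (a + b) n = a n + b n. Proof. by []. Qed.
Lemma psN a n : (- a) n = - a n. Proof. by []. Qed.
Lemma ps1 n : (1 : series K) n = (n == 0%N)%:R. Proof. by []. Qed.
Lemma psM a b n : (a * b) n = \sum_(i < n.+1) a i * b (n - i)%N.
Proof. by []. Qed.

Lemma ps_sum (I : Type) (r : seq I) (P : pred I) (F : I -> series K) n :
  (\sum_(i <- r | P i) F i) n = \sum_(i <- r | P i) F i n.
Proof. by apply: (big_morph (fun a : series K => a n)). Qed.

Lemma ps_exp_expr a j : ps_exp a j = a ^+ j :> series K.
Proof. by elim: j => //= j IH; rewrite exprS -IH. Qed.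

Definition psC (k : K) : series K := fun n => if n == 0%N then k else 0.
Definition psX : series K := fun n => (n == 1%N)%:R.

Lemma psCM k a n : (psC k * a) n = k * a n.
Proof.
rewrite psM big_ord_recl big1 ?addr0 /psC /= ?subn0 //.
by move=> i _; rewrite mul0r.
Qed.

Lemma psXM0 a : (psX * a) 0%N = 0.
Proof. by rewrite psM big_ord1 /psX mul0r. Qed.

Lemma psXMS a n : (psX * a) n.+1 = a n.
Proof.
rewrite psM big_ord_recl big_ord_recl big1 => [|i _]; rewrite /psX /= ?mul0r //.
by rewrite add0r mul1r addr0 subn1.
Qed.

Lemma psCD k m : psC (k + m) = psC k + psC m.
Proof. by apply/funext=> -[|n]; rewrite psD /psC //= addr0. Qed.

Lemma psC1 : psC 1 = 1.
Proof. by apply/funext=> -[|n]. Qed.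

Lemma psC_nat n : psC n%:R = n%:R.
Proof.
elim: n => [|n IH]; first by apply/funext=> -[|n].
by rewrite !mulrS psCD IH psC1.
Qed.
Lemma psCMC k m : psC (k * m) = psC k * psC m.
Proof. by apply/funext=> n; rewrite psCM /psC; case: eqP; rewrite ?mulr0. Qed.

Lemma psCN k : psC (- k) = - psC k.
Proof. by apply/funext=> n; rewrite psN /psC; case: eqP; rewrite ?oppr0. Qed.

Lemma ps_cancel a b : a 0%N != 0 -> a * b = 0 -> b = 0.
Proof.
move=> a0 ab; apply/funext=> n; elim/ltn_ind: n => n IH.
have /eqP := congr1 (@^~ n) ab.
rewrite /= psM big_ord_recl big1 => [|i _].
  by rewrite addr0 subn0 mulf_eq0 (negPf a0) => /eqP.
rewrite lift0 IH ?mulr0 //.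
by case: n i {IH} => [[]|n i] //; rewrite subSS ltnS leq_subr.
Qed.

(** The derivation x d/dx. It preserves the degree, so no index shift is needed, and d/dx (x^-p g)
    is x^-(p+1) ([euler g] - p g). *)
Definition euler a : series K := fun n => n%:R * a n.

Lemma eulerE a n : euler a n = n%:R * a n. Proof. by []. Qed.

Lemma eulerD a b : euler (a + b) = euler a + euler b.
Proof. by apply/funext=> n; rewrite psD !eulerE psD mulrDr. Qed.

Lemma eulerN a : euler (- a) = - euler a.
Proof. by apply/funext=> n; rewrite psN !eulerE psN mulrN. Qed.

Lemma eulerM a b : euler (a * b) = euler a * b + a * euler b.
Proof.
apply/funext=> n; rewrite psD eulerE !psM mulr_sumr -big_split /=.
apply: eq_bigr => i _; rewrite /euler.
have -> : n%:R = i%:R + (n - i)%:R :> K by rewrite -natrD subnKC ?leq_ord.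
ring.
Qed.

Lemma eulerC k : euler (psC k) = 0.
Proof. by apply/funext=> -[|n]; rewrite eulerE /psC ?mul0r ?mulr0. Qed.

Lemma eulerX : euler psX = psX.
Proof. by apply/funext=> -[|[|n]]; rewrite eulerE /psX ?mul0r ?mulr0 ?mulr1. Qed.

End SeriesRing.

(** * Integer powers of log(1 + y) *)

Section LogSeries.
Variable K : numFieldType.
Implicit Types a b d : series K.

Lemma binz0 (m : int) : binz K m 0 = 1.
Proof. by rewrite /binz big_ord0 fact0 divr1. Qed.

Lemma binzS (m : int) i : i.+1%:R * binz K m i.+1 = (m%:~R - i%:R) * binz K m i.
Proof.
rewrite /binz big_ord_recr /= factS natrM.
have i0 : i.+1%:R != 0 :> K by rewrite pnatr_eq0.
have -> : (m - i%:Z)%:~R = m%:~R - i%:R :> K by rewrite intrB.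
have f0 : i`!%:R != 0 :> K by rewrite pnatr_eq0 -lt0n fact_gt0.
by field; rewrite f0 nat1r i0.
Qed.

Lemma binz_pascal (m : int) i : binz K (m + 1) i.+1 = binz K m i.+1 + binz K m i.
Proof.
have i0 j : j.+1%:R != 0 :> K by rewrite pnatr_eq0.
elim: i => [|i IH].
  by rewrite -[LHS](mulKf (i0 0%N)) -[binz K m 1](mulKf (i0 0%N)) !binzS !binz0 invr1; ring.
apply: (mulfI (i0 i.+1)); rewrite mulrDr !binzS IH.
have := binzS m i; rewrite intrD mulrDr.
move=> /(congr1 (fun z => z - i%:R * binz K m i)) E.
have -> : (m%:~R - i.+1%:R) * binz K m i.+1 = (m%:~R - i%:R) * binz K m i.+1 - binz K m i.+1.
  by rewrite -natr1; ring.
rewrite -!natr1; move: E; rewrite -!natr1 => E.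
transitivity ((m%:~R - i%:R) * binz K m i.+1 + (m%:~R - i%:R) * binz K m i); first by ring.
rewrite -(binzS m i) -natr1; ring.
Qed.

Lemma binz_0 i : binz K 0 i = (i == 0%N)%:R.
Proof.
case: i => [|i]; first exact: binz0.
by rewrite /binz big_ord_recl /= subr0 !mul0r.
Qed.

Lemma ps_expr_eq0 a j n : a 0%N = 0 -> (n < j)%N -> (a ^+ j) n = 0.
Proof.
move=> a0; elim: j n => // j IH n nj; rewrite exprS psM.
apply: big1 => -[[|i] /= ilt] _; first by rewrite a0 mul0r.
by rewrite (IH (n - i.+1)%N) ?mulr0 //; lia.
Qed.

(** Unlike in [ps_expz], the truncation does not depend on the coefficient, so that the sum can be
    handled in the series ring. *)
Definition binom_sum (t : series K) (m : int) N : series K :=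
  \sum_(j < N) psC (binz K m j) * t ^+ j.

Lemma ps_expz_trunc a m N n : a 0%N = 1 -> (n < N)%N ->
  ps_expz a m n = binom_sum (a - 1) m N n.
Proof.
move=> a0 nN; rewrite /binom_sum ps_sum /ps_expz.
rewrite (big_ord_widen N (fun j => binz K m j
  * ps_exp (fun k => a k - (k == 0%N)%:R) j n) nN) big_mkcond /=.
apply: eq_bigr => j _; rewrite psCM -ps_exp_expr.
case: ltnP => // nj.
rewrite ps_exp_expr ps_expr_eq0 ?mulr0 //.
by rewrite psD psN ps1 a0 subrr.
Qed.

Lemma eq_psM a a' b b' n :
  (forall i, (i <= n)%N -> a i = a' i) -> (forall i, (i <= n)%N -> b i = b' i) ->
  (a * b) n = (a' * b') n.
Proof.
move=> Ea Eb; rewrite !psM; apply: eq_bigr => i _.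
by rewrite Ea ?Eb ?leq_subr ?leq_ord.
Qed.

(** Pascal's rule on truncated binomial sums; the term left over has order at least n + 1 and does
    not reach the coefficient n. *)
Lemma ps_expzS a m : a 0%N = 1 -> ps_expz a (m + 1) = a * ps_expz a m :> series K.
Proof.
move=> a0; apply/funext=> n.
rewrite (ps_expz_trunc _ a0 (N := n.+2)) //.
rewrite (@eq_psM _ a _ (binom_sum (a - 1) m n.+1) n) //; last first.
  by move=> i ile; apply: ps_expz_trunc.
have -> : binom_sum (a - 1) (m + 1) n.+2 = a * binom_sum (a - 1) m n.+1
    + psC (binz K m n.+1) * (a - 1) ^+ n.+1.
  set t := a - 1; have -> : a = 1 + t by rewrite /t addrC subrK.
  transitivity (binom_sum t m n.+2 + t * binom_sum t m n.+1); last first.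
    by rewrite {1}/binom_sum big_ord_recr -/(binom_sum t m n.+1) /=; ring.
  rewrite /binom_sum !(big_ord_recl n.+1) !binz0 /= -addrA mulr_sumr -big_split.
  congr (_ + _); apply: eq_bigr => j _ /=.
  by rewrite binz_pascal psCD exprS; ring.
rewrite psD psCM ps_expr_eq0 ?mulr0 ?addr0 //.
by rewrite psD psN ps1 a0 subrr.
Qed.

Lemma ps_expz0 a : ps_expz a 0 = 1 :> series K.
Proof.
apply/funext=> n; rewrite /ps_expz big_ord_recl big1 => [|i _].
  by rewrite binz0 mul1r addr0.
by rewrite binz_0 mul0r.
Qed.

Lemma ps_expz_coef0 a m : ps_expz a m 0 = 1.
Proof. by rewrite /ps_expz big_ord1 binz0 mul1r. Qed.

Local Notation l := (log1p_div K : series K).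
Local Notation X := (psX K).
(* (y^-1 log (1 + y)) ^ m *)
Definition logz (m : int) : series K := ps_expz l m.

Lemma log0 : l 0%N = 1.
Proof. by rewrite /log1p_div expr0 divr1. Qed.

Lemma logzS m : logz (m + 1) = l * logz m.
Proof. exact: ps_expzS log0. Qed.

Lemma log_inj a b : l * a = l * b -> a = b.
Proof.
move/eqP; rewrite -subr_eq0 -mulrBr => /eqP /ps_cancel.
by rewrite log0 oner_eq0 => /(_ isT)/eqP; rewrite subr_eq0 => /eqP.
Qed.

(* [(1 + y) (d/dy) log (1 + y) = 1] *)
Lemma euler_log : (1 + X) * (l + euler l) = 1.
Proof.
have E n : (l + euler l) n = (-1) ^+ n.
  rewrite psD eulerE /log1p_div.
  by rewrite -[X in X + _]mul1r -mulrDl addrC natr1 mulrC divfK // pnatr_eq0.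
apply/funext=> -[|n]; rewrite mulrDl mul1r psD ?psXM0 ?psXMS !E ?addr0 //.
by rewrite exprS mulN1r addNr ps1.
Qed.

(* [(1 + y) (d/dy) log (1 + y) ^ m = m log (1 + y) ^ (m - 1)] *)
Lemma euler_logz m :
  (1 + X) * (psC m%:~R * logz m + euler (logz m)) = psC m%:~R * logz (m - 1).
Proof.
have step k : (1 + X) * (psC (k + 1)%:~R * logz (k + 1) + euler (logz (k + 1))) =
   logz k + l * ((1 + X) * (psC k%:~R * logz k + euler (logz k))).
  rewrite logzS eulerM intrD psCD psC1.
  transitivity ((1 + X) * (l + euler l) * logz k
    + l * ((1 + X) * (psC k%:~R * logz k + euler (logz k)))); first by ring.
  by rewrite euler_log mul1r.
elim/int_ind: m => [|n IH|n IH].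
- rewrite /logz ps_expz0 (_ : psC _ = 0); last by apply/funext=> -[].
  by rewrite -psC1 eulerC !mul0r addr0 mulr0.
- rewrite intS (addrC (Posz 1)) step IH addrK.
  by rewrite mulrCA -logzS subrK intrD psCD psC1; ring.
(* Going down, [step] yields the claim multiplied by [l], which cancels since its constant term is
   1. *)
- have := step (- n.+1%:Z).
  rewrite (_ : - n.+1%:Z + 1 = - n%:Z); last by lia.
  rewrite IH (_ : - n%:Z - 1 = - n.+1%:Z); last by lia.
  set k := - n.+1%:Z; rewrite (_ : - n%:Z = k + 1); last by rewrite /k; lia.
  move=> E; apply: log_inj.
  rewrite [RHS]mulrCA -logzS subrK; move/eqP: E.
  rewrite intrD psCD psC1 mulrDl mul1r addrC -subr_eq0 opprD addrACA subrr add0r.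
  by rewrite subr_eq0 => /eqP.
Qed.

Lemma logz_rec m n :
  (m%:~R + n.+1%:R) * logz m n.+1 + (m%:~R + n%:R) * logz m n
    = m%:~R * logz (m - 1) n.+1.
Proof.
have := congr1 (@^~ n.+1) (euler_logz m).
rewrite /= mulrDl mul1r psD psXMS !psD !psCM !eulerE => <-; ring.
Qed.

(** This is Res_y log(1 + y)^(-n-1), which equals Res_x x^(-n-1) e^x under y = e^x - 1. At m = -n-1
    the first term of [logz_rec] vanishes, leaving a recursion in n. *)
Lemma logz_diag n : logz (- n.+1%:Z) n = n`!%:R^-1.
Proof.
elim: n => [|n IH]; first by rewrite /logz ps_expz_coef0 fact0 invr1.
have n0 : n.+1%:R != 0 :> K by rewrite pnatr_eq0.
have := logz_rec (- n.+1%:Z) n.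
rewrite IH (_ : - n.+1%:Z - 1 = - n.+2%:Z); last by lia.
rewrite intrN addNr mul0r add0r mulNr => E.
rewrite factS natrM invfM -[LHS](mulKf n0); congr (_ * _).
by apply: oppr_inj; rewrite -[LHS]E; ring.
Qed.

Lemma psXnM i a n : (X ^+ i * a) n = if (i <= n)%N then a (n - i)%N else 0.
Proof.
elim: i n => [|i IH] [|n]; rewrite ?expr0 ?mul1r ?subn0 // exprS -mulrA.
  by rewrite psXM0.
by rewrite psXMS IH ltnS subSS.
Qed.

Definition exp_log_sum N : series K :=
  \sum_(i < N) psC i`!%:R^-1 * (X ^+ i * logz i).

Lemma exp_log_sumS N n : (n < N)%N -> exp_log_sum N.+1 n = exp_log_sum N n.
Proof.
move=> nN; rewrite /exp_log_sum big_ord_recr /= psD psCM psXnM leqNgt nN.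
by rewrite mulr0 addr0.
Qed.

Lemma eulerXn i : euler (X ^+ i) = psC i%:R * X ^+ i.
Proof.
elim: i => [|i IH].
  by rewrite expr0 mulr1 -psC1 eulerC; apply/funext=> -[].
by rewrite exprS eulerM IH eulerX -natr1 psCD psC1; ring.
Qed.

(** The equation (1 + y) f' = f for f = exp(log(1 + y)): by [euler_logz] each term of the
    exponential differentiates into the previous one, whence the two bounds. *)
Lemma euler_exp_log N : (1 + X) * euler (exp_log_sum N.+1) = X * exp_log_sum N.
Proof.
rewrite /exp_log_sum (big_morph _ (@eulerD K) (_ : euler 0 = 0)); last first.
  by apply/funext=> n; rewrite eulerE mulr0.
rewrite !mulr_sumr big_ord_recl /= expr0 mul1r /logz ps_expz0 mulr1 eulerC.
rewrite mulr0 add0r; apply: eq_bigr => i _; rewrite -!/(logz _).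
rewrite /bump leq0n add1n eulerM eulerC mul0r add0r eulerM eulerXn.
have := euler_logz i.+1; rewrite (_ : i.+1%:Z - 1 = i); last by lia.
move=> E.
transitivity (psC i.+1`!%:R^-1 * X ^+ i.+1 *
   ((1 + X) * (psC i.+1%:~R * logz i.+1 + euler (logz i.+1)))); first by ring.
rewrite E factS natrM invfM psCMC exprS.
have U : psC i.+1%:R^-1 * psC i.+1%:R = 1 :> series K.
  by rewrite -psCMC mulVf ?psC1 // pnatr_eq0.
by rewrite -pmulrn -[RHS]mul1r -U; ring.
Qed.

(* [exp (log (1 + y)) = 1 + y]; [exp_log_sum N] truncates the left-hand side. *)
Lemma exp_logE N n : (n < N)%N -> exp_log_sum N n = (1 + X) n.
Proof.
have stable M k m : (m < M)%N -> exp_log_sum (M + k) m = exp_log_sum M m.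
  by move=> mM; elim: k => [|k IH]; rewrite ?addn0 // addnS exp_log_sumS ?ltn_addr.
suff main m : exp_log_sum m.+1 m = (1 + X) m.
  by move=> nN; rewrite -main -(subnKC nN) stable.
elim: m => [|m IH].
  by rewrite /exp_log_sum big_ord1 expr0 mul1r fact0 invr1 psC1 mul1r /logz ps_expz0
     psD ps1 /psX addr0.
have := congr1 (@^~ m.+1) (euler_exp_log m.+1).
rewrite /= mulrDl mul1r psD !psXMS !eulerE (exp_log_sumS (ltnSn m)) IH => E.
have m0 : m.+1%:R != 0 :> K by rewrite pnatr_eq0.
apply: (mulfI m0); rewrite -[LHS](addrK (m%:R * (1 + X) m)) E.
rewrite !psD !ps1 /psX; case: m {IH E m0} => [|[|m]] /=; ring.
Qed.

(** Multiply exp(log(1 + y)) = 1 + y by [logz (- n.+1)] and compare the coefficients of y^(n+1): the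
    zeroth term of the exponential cancels against 1, and [logz_diag] evaluates what remains on the
    right. *)
Lemma exp_log_conv n : \sum_(i < n.+1) logz (- (n - i)%N%:Z) (n - i)%N / i.+1`!%:R = n`!%:R^-1.
Proof.
have E : (logz (- n.+1%:Z) * exp_log_sum n.+2) n.+1
       = (logz (- n.+1%:Z) * (1 + X)) n.+1.
  by apply: eq_psM => // i ile; apply: exp_logE.
have logzD m k : logz m * logz (Posz k) = logz (m + k).
  elim: k => [|k IH]; first by rewrite addr0 /logz ps_expz0 mulr1.
  by rewrite intS (addrC (Posz 1)) logzS mulrCA IH -logzS addrA.
move: E; rewrite mulrDr mulr1 psD mulrC [in RHS]mulrC psXMS logz_diag.
rewrite /exp_log_sum mulr_suml ps_sum big_ord_recl /= fact0 invr1 psC1 expr0.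
rewrite !mul1r {1}/logz ps_expz0 mul1r => /addrI <-.
apply: eq_bigr => i _; rewrite /bump leq0n add1n. rewrite -!mulrA (mulrC (logz _)) logzD psCM psXnM.
rewrite ltnS leq_ord subSS mulrC; congr (_ * _); congr (logz _ _).
by have := ltn_ord i; lia.
Qed.
End LogSeries.

(** * The residue kernel phi, its Riccati equation and its derivatives *)

Section Cotangent.
Variables (K : numFieldType) (c : K).
Hypothesis c_neq0 : c != 0.
Local Notation X := (psX K).
Local Notation C := (@psC K).
Implicit Types a b g : series K.

(* [x phi(x)], where [phi(x) = c e^(cx) / (e^(cx) - 1)] is the residue kernel
   of the product; see [phix_expm1] for the closed form. *)
Definition phix : series K := fun i => c ^+ i * logz K (- i%:Z) i.

Lemma phix0 : phix 0%N = 1.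
Proof. by rewrite /phix expr0 mul1r /logz ps_expz_coef0. Qed.

(* [x^-1 (e^(cx) - 1)] *)
Definition expm1 : series K := fun i => c ^+ i.+1 / i.+1`!%:R.

(** Both sides are c e^(cx), the left one as phi(x) (e^(cx) - 1). On coefficients this is
    [exp_log_conv] scaled by a power of c. *)
Lemma phix_expm1 : phix * expm1 = C c * (1 + X * expm1).
Proof.
apply/funext=> n; rewrite psCM psD ps1 mulrC [LHS]psM.
transitivity (\sum_(i < n.+1) c ^+ n.+1 * (logz K (- (n - i)%N%:Z) (n - i)%N / i.+1`!%:R)).
  apply: eq_bigr => i _; rewrite /phix /expm1.
  have -> : c ^+ n.+1 = c ^+ i.+1 * c ^+ (n - i).
    by rewrite -exprD addSn subnKC // leq_ord.
  ring.
rewrite -mulr_sumr exp_log_conv; case: n => [|n].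
  by rewrite psXM0 addr0 invr1 expr1.
by rewrite psXMS add0r /expm1 exprS; ring.
Qed.

Lemma euler_expm1 : expm1 + euler expm1 = C c * (1 + X * expm1).
Proof.
apply/funext=> n; rewrite psCM !psD ps1 eulerE /expm1.
have n0 : n.+1%:R != 0 :> K by rewrite pnatr_eq0.
have -> (z : K) : z / n.+1`!%:R + n%:R * (z / n.+1`!%:R) = z / n`!%:R.
  rewrite -[X in X + _]mul1r -mulrDl nat1r factS natrM invfM.
  by rewrite mulrCA mulVKf.
case: n {n0} => [|n]; first by rewrite psXM0 addr0 invr1 expr1.
by rewrite psXMS add0r exprS mulrA.
Qed.

(* The Riccati equation [phi^2 = c phi - phi']. *)
Lemma riccati : phix ^+ 2 = C c * X * phix - euler phix + phix.
Proof.
(* It suffices to compare after multiplication by [expm1], where the closed form and its derivative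
   eliminate [euler phix]. *)
have e0 : expm1 0%N != 0 by rewrite /expm1 expr1 divr1.
apply/eqP; rewrite -subr_eq0; apply/eqP; apply: (ps_cancel e0).
have := congr1 (@euler K) phix_expm1.
rewrite !eulerM eulerD eulerM eulerX eulerC -psC1 eulerC psC1 => E.
have E1 := phix_expm1; have E2 := euler_expm1.
have W : euler phix * expm1 = C c * X * (expm1 + euler expm1) - phix * euler expm1.
  by rewrite -[LHS](addrK (phix * euler expm1)) E; ring.
have P : phix * euler expm1 = phix * (C c * (1 + X * expm1)) - C c * (1 + X * expm1).
  by rewrite -{1}E2 -E1; ring.
transitivity (phix * (phix * expm1) - C c * X * (phix * expm1)
   + euler phix * expm1 - phix * expm1); first by ring.
by rewrite W P E1 E2; ring.
Qed.

Lemma phix1 : phix 1%N *+ 2 = c.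
Proof.
have := congr1 (@^~ 1%N) riccati.
rewrite /= expr2 psM big_ord_recl big_ord1 /= !psD psN -mulrA psCM psXMS eulerE.
rewrite phix0 !mul1r !mulr1 addrNK.
by rewrite /bump leq0n subn0 addn0 mulr2n.
Qed.

(* Parity: [phi(- x) = c - phi(x)], i.e. [phix - c x / 2] is even. *)
Lemma phix_parity i : (-1) ^+ i * phix i = phix i - c * (i == 1%N)%:R.
Proof.
(* Removing the constant c / 2 from phi makes the Riccati equation invariant under x -> - x. So [k]
   and its reflection [k'] solve the same equation, and their difference [d] solves a homogeneous
   linear one. *)
pose k := phix - C (c / 2) * X.
pose alt a : series K := fun n => (-1) ^+ n * a n.
pose k' := alt k.
have altM a b : alt (a * b) = alt a * alt b.
  apply/funext=> n; rewrite {1}/alt !psM mulr_sumr; apply: eq_bigr => j _.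
  have -> : (-1) ^+ n = (-1) ^+ j * (-1) ^+ (n - j) :> K.
    by rewrite -exprD subnKC ?leq_ord.
  by rewrite /alt; ring.
pose z := C (c / 2) ^+ 2 * X ^+ 2.
have cE : C c = C (c / 2) + C (c / 2) by rewrite -psCD -splitr.
have kE : k ^+ 2 = k - euler k + z.
  rewrite /k /z eulerD eulerN eulerM eulerC eulerX mul0r add0r.
  transitivity (phix ^+ 2 - (C (c / 2) + C (c / 2)) * X * phix + C (c / 2) ^+ 2 * X ^+ 2).
    by ring.
  by rewrite riccati -cE; ring.
have k'E : k' ^+ 2 = k' - euler k' + z.
  have altz : alt z = z.
    apply/funext=> n; rewrite /alt /z [C _ ^+ 2]expr2 -psCMC psCM.
    rewrite -[X ^+ 2]mulr1 psXnM ps1.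
    by case: n => [|[|[|n]]] //=; rewrite ?mulr0 // sqrrN expr1n mul1r.
  rewrite expr2 /k' -altM -expr2 kE -{2}altz; apply/funext=> n.
  by rewrite /alt !psD !psN !eulerE; ring.
pose d := k - k'.
have dE : (k + k' - 1) * d = - euler d.
  have -> : (k + k' - 1) * d = k ^+ 2 - k' ^+ 2 - d by rewrite /d; ring.
  by rewrite kE k'E /d eulerD eulerN; ring.
have k0 : k 0%N = 1 by rewrite /k psD psN psCM phix0 mulr0 subr0.
have k'0 : k' 0%N = 1 by rewrite /k' /alt k0 mulr1.
(* As [k + k' - 1] has constant term 1, once the lower coefficients of [d] vanish, [dE] in degree n
   reads (n + 1) d_n = 0. *)
have d0 n : d n = 0.
  elim/ltn_ind: n => n IH.
  have := congr1 (@^~ n) dE; rewrite /= psM big_ord_recl big1 => [|j _].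
    rewrite addr0 subn0 psN eulerE !psD psN ps1 k0 k'0 addrK mul1r => /eqP.
    by rewrite -subr_eq0 opprK -[X in X + _]mul1r -mulrDl nat1r mulf_eq0 pnatr_eq0 => /eqP.
  rewrite lift0 IH ?mulr0 //.
  by case: n j {IH} => [[]|n j] //; rewrite subSS ltnS leq_subr.
have := d0 i; rewrite /d /k' /alt psD psN /k psD psN psCM /psX.
case: eqP => [->|_] /=; last by rewrite !mulr0 !subr0 => /eqP; rewrite subr_eq0 => /eqP.
by rewrite -phix1 => _; rewrite expr1 mulN1r mulr1 mulr2n opprD addrA subrr add0r.
Qed.

(* [phi^(i) / i!], shifted by [x^(i + 1)]. *)
Definition dphix (i : nat) : series K := fun n => binz K (n%:Z - 1) i * phix n.

Lemma dphix0 : dphix 0 = phix.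
Proof. by apply/funext=> n; rewrite /dphix binz0 mul1r. Qed.

Lemma dphixS i : C i.+1%:R * dphix i.+1 = euler (dphix i) - C i.+1%:R * dphix i.
Proof.
apply/funext=> n; rewrite psD psN !psCM eulerE /dphix mulrA binzS intrB -natr1; ring.
Qed.

(* [- x^2 phi'(x)] *)
Definition phix' : series K := phix - euler phix.

Lemma phix'E : phix' = phix ^+ 2 - C c * X * phix.
Proof. by rewrite riccati /phix'; ring. Qed.

(* [nice p g] holds for the series with [x^-p g(x)] in the span of
   the [phi^k phi']. *)
Inductive nice : nat -> series K -> Prop :=
| nice_deriv : nice 2 phix'
| nice_phi p g : nice p g -> nice p.+1 (phix * g)
| nice_X p g : nice p g -> nice p.+1 (X * g)
| nice_scale p g k : nice p g -> nice p (C k * g)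
| nice_add p g g' : nice p g -> nice p g' -> nice p (g + g').

(** The span of the phi^k phi' is stable under d/dx, because the Riccati equation gives phi'' = c
    phi' - 2 phi phi'. *)
Lemma nice_euler p g : nice p g -> nice p.+1 (euler g - C p%:R * g).
Proof.
elim=> {p g} [|p g ng IH|p g ng IH|p g k ng IH|p g g' ng IH ng' IH'].
- have -> : euler phix' - C 2 * phix' = X * (C c * phix') + C (- 2) * (phix * phix').
    have -> : euler phix' = euler phix * phix + phix * euler phix
        - C c * X * phix - C c * X * euler phix.
      by rewrite phix'E expr2 eulerD eulerN !eulerM eulerC eulerX; ring.
    have -> : euler phix = phix - phix' by rewrite /phix'; ring.
    rewrite psCN psC_nat.
    transitivity ((phix ^+ 2 - C c * X * phix - phix') *+ 2
      + X * (C c * phix') - 2%:R * (phix * phix')); first by ring.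
    by rewrite -phix'E subrr mul0rn add0r; ring.
  apply: nice_add; first exact/nice_X/nice_scale/nice_deriv.
  exact/nice_scale/nice_phi/nice_deriv.
- have -> : euler (phix * g) - C p.+1%:R * (phix * g) =
    phix * (euler g - C p%:R * g) + (C (-1) * (phix * (phix * g)) + X * (C c * (phix * g))).
    rewrite eulerM -natr1 psCD psC1 psCN psC1.
    have -> : euler phix = phix - phix ^+ 2 + C c * X * phix by rewrite riccati; ring.
    ring.
  apply: nice_add; first exact: nice_phi.
  apply: nice_add; first exact/nice_scale/nice_phi/nice_phi.
  exact/nice_X/nice_scale/nice_phi.
- have -> : euler (X * g) - C p.+1%:R * (X * g) = X * (euler g - C p%:R * g).
    by rewrite eulerM eulerX -natr1 psCD psC1; ring.
  exact: nice_X.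
- have -> : euler (C k * g) - C p%:R * (C k * g) = C k * (euler g - C p%:R * g).
    by rewrite eulerM eulerC; ring.
  exact: nice_scale.
- have -> : euler (g + g') - C p%:R * (g + g') =
    (euler g - C p%:R * g) + (euler g' - C p%:R * g') by rewrite eulerD; ring.
  exact: nice_add.
Qed.

Lemma dphix_nice i : nice i.+2 (dphix i.+1).
Proof.
have scale n g : g = C n.+1%:R^-1 * (C n.+1%:R * g).
  by rewrite mulrA -psCMC mulVf ?psC1 ?mul1r // pnatr_eq0.
elim: i => [|i IH].
  rewrite (scale 0%N (dphix 1)) dphixS; apply: nice_scale.
  have -> : euler (dphix 0) - C 1 * dphix 0 = C (-1) * phix'.
    by rewrite dphix0 psCN psC1 /phix'; ring.
  exact/nice_scale/nice_deriv.
rewrite (scale i.+1 (dphix i.+2)) dphixS; apply: nice_scale.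
exact: nice_euler.
Qed.

(* [phi^(i)(- x) / i!], shifted by [(- x)^(i + 1)] *)
Definition dphix_opp (i : nat) : series K :=
  fun n => (-1) ^ (n%:Z - 1) * (-1) ^+ i * binz K (n%:Z - 1) i * phix n.

(** By parity, phi(- x) phi(x) = (c - phi) phi = phi', and phi^(i)(- x) = (-1)^(i+1) phi^(i)(x) for
    i > 0. *)
Lemma dphix_opp_nice i : nice i.+2 (dphix_opp i * phix).
Proof.
have sgn n : (-1) ^ (n%:Z - 1) = - (-1) ^+ n :> K.
  case: n => [|n]; first by rewrite sub0r exprN1 invrN1 expr0.
  by rewrite (_ : n.+1%:Z - 1 = n) ?exprS ?mulN1r ?opprK //; lia.
have E n : dphix_opp i n = (-1) ^+ i.+1 * binz K (n%:Z - 1) i *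
     (phix n - c * (n == 1%N)%:R).
  by rewrite -phix_parity /dphix_opp sgn exprS; ring.
case: i E => [|i] E.
  have -> : dphix_opp 0 * phix = C (-1) * phix'.
    have -> : dphix_opp 0 = C (-1) * (phix - C c * X).
      apply/funext=> n; rewrite E psCM psD psN psCM binz0 expr1; ring.
    by rewrite phix'E; ring.
  exact/nice_scale/nice_deriv.
have -> : dphix_opp i.+1 * phix = C ((-1) ^+ i.+2) * (phix * dphix i.+1).
  have -> : dphix_opp i.+1 = C ((-1) ^+ i.+2) * dphix i.+1.
    (* The constant c sits at n = 1, where [binz K 0 i.+1] is zero: differentiation kills it. *)
    apply/funext=> n; rewrite E psCM /dphix; case: (n =P 1%N) => [->|_] /=.
      by rewrite subrr binz_0 !mulr0 !mul0r mulr0.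
    by rewrite mulr0 subr0 mulrA.
  by ring.
exact/nice_scale/nice_phi/dphix_nice.
Qed.

End Cotangent.

(** * Finitely supported sums and linear combinations *)

Section FiniteSums.
Local Open Scope classical_set_scope.
Variable W : zmodType.

Lemma fsum_nat (F : nat -> W) N : (forall i, (N <= i)%N -> F i = 0) ->
  \sum_(i \in [set: nat]) F i = \sum_(i < N) F i.
Proof.
move=> F0; rewrite fsbig_ord; apply/esym/fsbig_widen => //= i [_ /= iN].
by apply: F0; rewrite leqNgt; apply/negP.
Qed.

Lemma fsum_int (F : int -> W) p N :
    (forall n, n < - p%:Z -> F n = 0) ->
    (forall n, N%:Z - p%:Z <= n -> F n = 0) ->
  \sum_(n \in [set: int]) F n = \sum_(i < N) F (i%:Z - p%:Z).
Proof.
move=> Flow Fhigh; rewrite (fsbig_ord _ _ (fun i : nat => F (i%:Z - p%:Z))).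
have inj : set_inj `I_N (fun i : nat => i%:Z - p%:Z) by move=> i j _ _ /= /addIr [].
rewrite -(fsbig_image _ _ F inj).
apply/esym/fsbig_widen => //= n [_ /= nN].
have [/Flow //|np] := ltP n (- p%:Z); apply: Fhigh; rewrite leNgt; apply/negP => nN'.
by apply: nN; exists (absz (n + p%:Z)) => /=; lia.
Qed.

End FiniteSums.

Section Convolution.
Variables (K : fieldType) (W : lmodType K).

(** Grouping by r = s + t turns a double residue, whose modes only depend on s + t, into one residue
    against the product of the kernels. *)
Lemma psM_sum (a b : series K) (G : nat -> W) N N1 N2 :
    (forall r, (N <= r)%N -> G r = 0) -> (N <= N1)%N -> (N <= N2)%N ->
  \sum_(s < N1) \sum_(t < N2) (a s * b t) *: G (s + t)%N
    = \sum_(r < N) (a * b) r *: G r.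
Proof.
move=> G0 N1N N2N.
have trunc (F : nat -> W) (n m : nat) : (n <= m)%N -> (forall r, (n <= r)%N -> F r = 0) ->
    \sum_(i < m) F i = \sum_(i < n) F i.
  move=> nm F0; rewrite -!(big_mkord xpredT F) (big_cat_nat (leq0n n) nm) //= [X in _ + X]big_nat.
  by rewrite [X in _ + X]big1 ?addr0 // => i /andP[ni _]; apply: F0.
rewrite (trunc (fun s => \sum_(t < N2) (a s * b t) *: G (s + t)%N) N) //; last first.
  by move=> r Nr; apply: big1 => t _; rewrite G0 ?scaler0 // (leq_trans Nr) ?leq_addr.
under [RHS]eq_bigr => r _.
  rewrite psM scaler_suml.
  rewrite (big_ord_widen N (fun s => (a s * b (r - s)%N) *: G r) (ltn_ord r)).
  rewrite big_mkcond /=; over.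
rewrite [RHS]exchange_big /=; apply: eq_bigr => s _.
rewrite (trunc (fun t => (a s * b t) *: G (s + t)%N) (N - s)%N); last first.
- by move=> r Nr; rewrite G0 ?scaler0 // -leq_subLR.
- by rewrite (leq_trans (leq_subr _ _)).
rewrite -(big_mkord xpredT (fun r => if (s < r.+1)%N then (a s * b (r - s)%N) *: G r else 0)).
rewrite (big_cat_nat (n := s)) //=; last by rewrite ltnW.
rewrite [X in X + _]big_nat [X in X + _]big1 ?add0r => [|r /andP[_ rs]]; last by rewrite ltnS leqNgt rs.
rewrite -[X in \sum_(X <= _ < _) _]add0n big_addn big_mkord; apply: eq_bigr => t _.
by rewrite ltnS leq_addl addnK addnC.
Qed.

Lemma linear_at0 (W' : lmodType K) (f : W -> W') : linear f -> f 0 = 0.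
Proof. by move=> lf; apply: (addIr (f 0)); rewrite -{1}[f 0]scale1r -lf scaler0 !add0r. Qed.

Lemma linear_comb (W' : lmodType K) (f : W -> W') I (r : seq I) (k : I -> K) (F : I -> W) :
  linear f -> f (\sum_(i <- r) k i *: F i) = \sum_(i <- r) k i *: f (F i).
Proof.
move=> lf; elim: r => [|i r IH]; first by rewrite !big_nil linear_at0.
by rewrite !big_cons lf IH.
Qed.

Lemma linear_scale (W' : lmodType K) (f : W -> W') k x : linear f -> f (k *: x) = k *: f x.
Proof. by move=> lf; rewrite -[k *: x]addr0 lf linear_at0 // addr0. Qed.

Lemma linear_add (W' : lmodType K) (f : W -> W') x y : linear f -> f (x + y) = f x + f y.
Proof. by move=> lf; rewrite -[x]scale1r lf !scale1r. Qed.

End Convolution.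

(** * Residues of Y(u, x)v against Laurent kernels *)

Section Residues.
Variables (R : realType) (V : VOA R).
Local Notation K := (R[i]).
Local Notation c := (@twopii R).
Local Notation X := (psX K).
Local Notation C := (@psC K).
Implicit Types (u v w : V) (g : series K).

Lemma twopii_neq0 : c != 0.
Proof.
rewrite /twopii mulf_eq0 negb_or neq0Ci andbT eq_complex /= eqxx andbT.
by rewrite mulf_neq0 ?pnatr_eq0 // gt_eqF // pi_gt0.
Qed.

Lemma mode0l n v : voa_mode (0 : V) n v = 0.
Proof. exact: (linear_at0 (voa_linear_l n v)). Qed.

Lemma mode0r u n : voa_mode u n (0 : V) = 0.
Proof. exact: (linear_at0 (voa_linear_r u n)). Qed.

Lemma mode_trunc u v : {N : nat | forall n : int, N%:Z <= n -> voa_mode u n v = 0}.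
Proof.
apply: cid; have [N HN] := voa_trunc u v.
by exists `|N|%N => n Nn; apply: HN; lia.
Qed.

(** Some bound beyond which the modes vanish, fixed by choice and not necessarily the least. *)
Definition pole_order u v : nat := sval (mode_trunc u v).

Lemma mode_pole_order u v n : (pole_order u v)%:Z <= n -> voa_mode u n v = 0.
Proof. exact: (svalP (mode_trunc u v)). Qed.

(* [Res_x x^(- p) g(x) Y(u, x) v] *)
Definition res p g u v : V := \sum_(i < pole_order u v + p) g i *: voa_mode u (i%:Z - p%:Z) v.

(** Any larger range gives the same residue, so that residues with different pole orders can be
    compared over a common range. *)
Lemma resE p g u v N : (pole_order u v + p <= N)%N ->
  res p g u v = \sum_(i < N) g i *: voa_mode u (i%:Z - p%:Z) v.
Proof.
move=> le; rewrite /res (big_ord_widen N (fun i => g i *: voa_mode u (i%:Z - p%:Z) v) le).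
rewrite big_mkcond; apply: eq_bigr => i _; case: ltnP => // lei.
by rewrite mode_pole_order ?scaler0 //; lia.
Qed.

Lemma res0 p g u : res p g u 0 = 0.
Proof. by rewrite /res big1 // => i _; rewrite mode0r scaler0. Qed.

Lemma res_linear_l p g v : linear (fun u => res p g u v).
Proof.
move=> k a b; pose N := (pole_order (k *: a + b) v + pole_order a v + pole_order b v + p)%N.
rewrite !(@resE _ _ _ _ N) /N; [|lia..].
rewrite scaler_sumr -big_split; apply: eq_bigr => i _ /=.
by rewrite voa_linear_l scalerDr !scalerA mulrC.
Qed.

Lemma res_linear_r p g u : linear (res p g u).
Proof.
move=> k a b; pose N := (pole_order u (k *: a + b) + pole_order u a + pole_order u b + p)%N.
rewrite !(@resE _ _ _ _ N) /N; [|lia..].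
rewrite scaler_sumr -big_split; apply: eq_bigr => i _ /=.
by rewrite voa_linear_r scalerDr !scalerA mulrC.
Qed.

Lemma resD p g g' u v : res p (g + g') u v = res p g u v + res p g' u v.
Proof. by rewrite -big_split; apply: eq_bigr => i _ /=; rewrite psD scalerDl. Qed.

Lemma resZ p k g u v : res p (C k * g) u v = k *: res p g u v.
Proof. by rewrite scaler_sumr; apply: eq_bigr => i _; rewrite psCM scalerA. Qed.

Lemma resX p g u v : res p.+1 (X * g) u v = res p g u v.
Proof.
rewrite (@resE p.+1 _ _ _ (pole_order u v + p).+1) ?addnS // big_ord_recl psXM0 scale0r add0r.
by apply: eq_bigr => i _; rewrite lift0 psXMS; congr (_ *: voa_mode _ _ _); lia.
Qed.

Local Notation D := (voa_L (-1)).

Lemma mode_D u n v : voa_mode (D u) n v = - n%:~R *: voa_mode u (n - 1) v.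
Proof. exact: voa_derivative. Qed.

Lemma D_linear : linear (D : V -> V).
Proof. exact: voa_linear_r. Qed.

(* Integration by parts: [Res f Y(L(-1)u, x) = - Res f' Y(u, x)]. *)
Lemma res_D p g u v : res p g (D u) v = res p.+1 (C p%:R * g - euler g) u v.
Proof.
rewrite (@resE p _ _ _ (pole_order u v + pole_order (D u) v + p).+1); last lia.
rewrite (@resE p.+1 _ _ _ (pole_order u v + pole_order (D u) v + p).+1); last lia.
apply: eq_bigr => i _; rewrite mode_D scalerA psD psN psCM eulerE.
congr (_ *: voa_mode _ _ _); last lia.
rewrite intrB; ring.
Qed.

Local Notation phi := (phix c).

(* The residue kernel [c e^(cx) / (e^(cx) - 1)^n]. *)
Definition kern (n : nat) : series K := fun i =>
  c ^ (i%:Z - n%:Z + 1) * logz K (n%:Z - 1 - i%:Z) i.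

Lemma kern1 : kern 1 = phi.
Proof.
apply/funext=> i; rewrite /kern /phix subrK exprnP.
by congr (_ * logz _ _ _); lia.
Qed.

(** With f_n = c e^(cx) / (e^(cx) - 1)^n, this is n f_(n+1) = (1 - n) f_n - c^-1 f_n'. On
    coefficients it is [logz_rec]. *)
Lemma kernS n :
  C n%:R * kern n.+1 = C (1 - n%:R) * (X * kern n) + C c^-1 * (C n%:R * kern n - euler (kern n)).
Proof.
have c0 := twopii_neq0.
apply/funext=> -[|i]; rewrite !(psD, psCM, psN, psXM0, psXMS, eulerE) /kern.
  rewrite /logz !ps_expz_coef0 mulr0 !add0r mul0r subr0 !mulr1 [RHS]mulrCA; congr (_ * _).
  by rewrite -exprN1 -expfzDr //; congr (_ ^ _); lia.
set m := n%:Z - 1 - i%:Z.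
have -> : n.+1%:Z - 1 - i.+1%:Z = m by rewrite /m; lia.
have -> : n%:Z - 1 - i.+1%:Z = m - 1 by rewrite /m; lia.
have -> : i.+1%:Z - n.+1%:Z + 1 = i%:Z - n%:Z + 1 by lia.
have -> : c ^ (i.+1%:Z - n%:Z + 1) = c * c ^ (i%:Z - n%:Z + 1).
  by rewrite -{2}[c]expr1z -expfzDr //; congr (_ ^ _); lia.
have := logz_rec K m i; set L := logz K (m - 1) i.+1.
have -> : m%:~R = n%:R - 1 - i%:R :> K by rewrite /m !intrB.
move=> E; set e := c ^ _.
transitivity (e * (n%:R * logz K m i.+1)); first by ring.
have -> : n%:R * logz K m i.+1 = (n%:R - 1 - i%:R) * L - (n%:R - 1) * logz K m i.
  by rewrite -E -natr1; ring.
have -> : c^-1 * (n%:R * (c * e * L) - i.+1%:R * (c * e * L)) =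
          (c^-1 * c) * ((n%:R - i.+1%:R) * e * L) by ring.
by rewrite mulVf // -natr1; ring.
Qed.

(** The mode u_(i-n) comes with log(1 + y)^(n-1-i), whose coefficient at y^(n-1) is
    [logz K (n - 1 - i) i], and 0 for i < 0. *)
Lemma Ylog_res (n : nat) u v : Res (mul_yX (- n%:Z) (Ylog u v)) = res n (kern n) u v.
Proof.
rewrite /Res /mul_yX opprK /Ylog (@fsum_int _ _ n (pole_order u v + n)) => [|m mn|m mN].
- apply: eq_bigr => i _; rewrite /kern /log1p_expz.
  have -> : -1 + n%:Z - (- (i%:Z - n%:Z) - 1) = Posz i by lia.
  have -> : - (i%:Z - n%:Z) - 1 = n%:Z - 1 - i%:Z by lia.
  rewrite exprz_inv; congr ((_ ^ _ * _) *: _); lia.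
- rewrite /log1p_expz.
  have -> : -1 + n%:Z - (- m - 1) = Negz (absz (n%:Z + m + 1)) by lia.
  by rewrite mulr0 scale0r.
- by rewrite mode_pole_order ?scaler0 //; lia.
Qed.

Lemma bulletE u v : bullet u v = res 1 phi u v.
Proof. by rewrite -kern1 -Ylog_res. Qed.

Lemma bullet_linear_l v : linear (fun u : V => bullet u v).
Proof. by move=> k a b; rewrite !bulletE res_linear_l. Qed.

Lemma bullet_linear_r u : linear (bullet u).
Proof. by move=> k a b; rewrite !bulletE res_linear_r. Qed.

End Residues.

(** * The product modulo [Otilde V] *)

Section ZhuAlgebra.
Variables (R : realType) (V : VOA R).
Local Notation K := (R[i]).
Local Notation c := (@twopii R).
Local Notation X := (psX K).
Local Notation C := (@psC K).
Local Notation D := (@voa_L R V (-1)).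
Local Notation phi := (phix c).
Implicit Types (u v w : V) (g : series K).

(** By parts, phi becomes - phi', which is c times the kernel for n = 2 by [kernS] at 1. *)
Lemma D_bullet_Otilde u v : bullet (D u) v \in Otilde V.
Proof.
have -> : bullet (D u) v = c *: res 2 (kern R 2) u v.
  have -> : kern R 2 = C c^-1 * (C 1 * phi - euler phi).
    by have := kernS R 1; rewrite kern1 subrr !psC1 !mul1r => ->; apply/funext=> n;
      rewrite psD psCM mul0r add0r.
  by rewrite resZ scalerA mulfV ?twopii_neq0 // scale1r bulletE res_D.
apply: rpredZ; apply/asboolP; exists 1%N, (fun=> 1), (fun=> res 2 (kern R 2) u v).
split; last by rewrite big_ord1 scale1r.
by move=> _; exists 2, u, v; rewrite -Ylog_res.
Qed.

Lemma bullet_vac_r u : bullet u (voa_vac V) = u.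
Proof.
rewrite bulletE /res addn1 big_ord_recl phix0 scale1r.
rewrite (_ : 0%Z - 1%Z = -1) ?sub0r // voa_creation big1 ?addr0 // => i _.
by rewrite voa_creation_reg ?scaler0 // lift0; lia.
Qed.

Lemma bullet_vac_l u : bullet (voa_vac V) u = u.
Proof.
rewrite bulletE /res addn1 big_ord_recl phix0 scale1r.
rewrite voa_vacuum sub0r eqxx big1 ?addr0 // => i _.
by rewrite voa_vacuum lift0 (_ : (_ == -1) = false) ?scaler0 //.
Qed.

Lemma D_Otilde u : D u \in Otilde V.
Proof. by rewrite -[D u]bullet_vac_r D_bullet_Otilde. Qed.

(* Every residue against [x^- p g] is that of [phi'] for another [u]. *)
Definition good p g := forall u, exists u', forall v, res p g u v = bullet (D u') v.

Lemma good_scale p g k : good p g -> good p (C k * g).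
Proof.
move=> gg u; have [u' E] := gg u; exists (k *: u') => v.
by rewrite resZ E (linear_scale _ _ (@D_linear R V)) (linear_scale _ _ (@bullet_linear_l R V v)).
Qed.

Lemma good_add p g g' : good p g -> good p g' -> good p (g + g').
Proof.
move=> gg gg' u; have [a Ea] := gg u; have [b Eb] := gg' u; exists (a + b) => v.
by rewrite resD Ea Eb (linear_add _ _ (@D_linear R V)) (linear_add _ _ (@bullet_linear_l R V v)).
Qed.

Lemma good_X p g : good p g -> good p.+1 (X * g).
Proof. by move=> gg u; have [u' E] := gg u; exists u' => v; rewrite resX. Qed.

Lemma good_D p g : good p g -> good p.+1 (C p%:R * g - euler g).
Proof. by move=> gg u; have [u' E] := gg (D u); exists u' => v; rewrite -res_D. Qed.

(** Induction along [kernS], from phi' at n = 0: each generator of [Otilde V] is itself of the form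
    (L(-1)u') . v. *)
Lemma kern_good n : good n.+2 (kern R n.+2).
Proof.
have step m : kern R m.+2 = C m.+1%:R^-1 *
    (C (1 - m.+1%:R) * (X * kern R m.+1) +
     C c^-1 * (C m.+1%:R * kern R m.+1 - euler (kern R m.+1))).
  by rewrite -kernS mulrA -psCMC mulVf ?psC1 ?mul1r // pnatr_eq0.
elim: n => [|n IH]; rewrite step; apply: good_scale.
  rewrite subrr (_ : C 0 = 0) ?mul0r ?add0r; last by apply/funext=> -[].
  by apply: good_scale => u; exists u => v; rewrite -res_D kern1 bulletE.
by apply: good_add; apply: good_scale; [apply: good_X|apply: good_D].
Qed.

(** A simultaneous induction. As phi^k phi' = (phi^(k+1))' / (k + 1), the second claim gives the
    first; as phi^(k+2) = c phi^(k+1) - phi^k phi', both claims at k give the second at k + 1. *)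
Lemma phix'_good k :
  good k.+2 (phi ^+ k * phix' c) /\ (forall u, exists u', forall v,
    res k.+1 (phi ^+ k.+1) (D u) v = bullet (D u') v).
Proof.
(* [k phi^(k - 1) phi' = (phi^k)'] *)
have deriv j u v : res j.+2 (C j.+1%:R * (phi ^+ j * phix' c)) u v =
    res j.+1 (phi ^+ j.+1) (D u) v.
  have eulerX n a : euler (a ^+ n.+1) = C n.+1%:R * (a ^+ n * euler a) :> series K.
    elim: n => [|n IH]; first by rewrite expr1 expr0 psC1 !mul1r.
    by rewrite exprS eulerM IH -(natr1 n.+1) psCD psC1 !exprS; ring.
  rewrite res_D eulerX; congr (res _ _ _ _); rewrite /phix' exprSr; ring.
have main j : (forall u, exists u', forall v,
    res j.+1 (phi ^+ j.+1) (D u) v = bullet (D u') v) ->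
    good j.+2 (phi ^+ j * phix' c).
  move=> Ej u; have [u' E] := Ej u; exists (j.+1%:R^-1 *: u') => v.
  rewrite (linear_scale _ _ (@D_linear R V)) (linear_scale _ _ (@bullet_linear_l R V v)).
  by rewrite -E -deriv resZ scalerA mulVf ?scale1r // pnatr_eq0.
elim: k => [|k [IHg IHD]].
  suff H u : exists u', forall v, res 1 (phi ^+ 1) (D u) v = bullet (D u') v.
    by split=> //; exact: main.
  by exists u => v; rewrite expr1 bulletE.
suff H u : exists u', forall v, res k.+2 (phi ^+ k.+2) (D u) v = bullet (D u') v.
  by split=> //; exact: main.
have [a Ea] := IHD u; have [b Eb] := IHg (D u).
exists (c *: a + b) => v.
have -> : phi ^+ k.+2 = C c * (X * phi ^+ k.+1) + phi ^+ k * phix' c.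
  by rewrite (phix'E (twopii_neq0 R)) !exprS; ring.
rewrite resD resZ resX Ea Eb (linear_add _ _ (@D_linear R V)) (linear_add _ _ (@bullet_linear_l R V v)).
by rewrite (linear_scale _ _ (@D_linear R V)) (linear_scale _ _ (@bullet_linear_l R V v)).
Qed.

Lemma nice_good p g : nice c p g -> good p g.
Proof.
(* The extra power of phi absorbs the constructor [nice_phi]. *)
move=> ng; suff H k : good (k + p) (phi ^+ k * g) by have := H 0%N; rewrite expr0 mul1r.
elim: ng k => {p g} [|p g _ IH|p g _ IH|p g k _ IH|p g g' _ IH _ IH'] j.
- by rewrite addn2; have [] := phix'_good j.
- by rewrite mulrA -exprSr addnS -addSn.
- by rewrite mulrCA addnS; apply: good_X.
- by rewrite mulrCA; apply: good_scale.
- by rewrite mulrDr; apply: good_add.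
Qed.

(** Replaces the generators for all n > 1 by the (L(-1)u) . v, to which associativity applies
    directly. *)
Lemma Otilde_ind (P : V -> Prop) :
    P 0 -> (forall k v w, P v -> P w -> P (k *: v + w)) ->
    (forall u v, P (bullet (D u) v)) -> forall w, w \in Otilde V -> P w.
Proof.
move=> P0 PD PB w /asboolP[n [k [f [Hf ->]]]].
have Pf i : P (f i).
  have [m [u [v [m1 ->]]]] := Hf i.
  have [j ->] : exists j : nat, m = j.+2 by exists (absz (m - 2)); lia.
  by rewrite Ylog_res; have [u' ->] := kern_good j u.
elim: (index_enum _) => [|i r IH]; first by rewrite big_nil.
by rewrite big_cons; apply: PD.
Qed.

Lemma jacobi_bound u v (l : int) :
  exists N : nat, forall i : nat, (N <= i)%N -> voa_mode u (l + i%:Z) v = 0.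
Proof. by exists (pole_order u v + absz l)%N => i Ni; apply: mode_pole_order; lia. Qed.

(* The vacuum case of the Jacobi identity gives
   [Y(u, x) v = e^(x L(-1)) Y(v, - x) u]; mod [L(-1) V] only [Y(v, - x) u]
   survives. *)
Lemma skew_symmetry u v (l : int) :
  voa_mode u l v - (-1) ^ (l + 1) *: voa_mode v l u \in Otilde V.
Proof.
(* On the vacuum, n = 0 kills the first sum, m = -1 leaves only i = 0 in the second, which is v_l u
   up to sign, and the right-hand side starts with u_l v. *)
have := @voa_jacobi R V u v (voa_vac V) l (-1) 0.
rewrite (@fsum_nat _ _ 0) => [|i _]; last first.
  by rewrite (@voa_creation_reg R V v) ?mode0r ?scaler0.
rewrite big_ord0 sub0r (@fsum_nat _ _ 1) => [|i i1]; last first.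
  by rewrite (@voa_creation_reg R V u) ?mode0r ?scaler0 //; lia.
rewrite big_ord1 addr0 voa_creation binz0 expr0 !mulr1 subr0 add0r.
have [N HN] := jacobi_bound u v l.
rewrite (@fsum_nat _ _ N.+1) => [|i Ni]; last first.
  by rewrite HN ?mode0l ?scaler0 // ltnW.
rewrite big_ord_recl binz0 scale1r addr0 subr0 voa_creation => E.
have -> : (-1) ^ (l + 1) = - (-1) ^ l :> K by rewrite expfzDr ?oppr_eq0 ?oner_eq0 // expr1z mulrN1.
rewrite scaleNr E opprD addrA subrr add0r rpredN rpred_sum // => i _.
apply: rpredZ; rewrite lift0; move: (voa_mode u _ v) => a.
(* The remaining terms are multiples of a_(-1-i) 1 = L(-1)^i a / i! with i > 0, hence lie in
   L(-1)V. *)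
have mode_vac (j : nat) b :
    voa_mode b (-1 - j.+1%:Z) (voa_vac V) =
    j.+1%:R^-1 *: voa_mode (D b) (-1 - j%:Z) (voa_vac V).
  have -> : voa_mode (D b) (-1 - j%:Z) (voa_vac V) =
      j.+1%:R *: voa_mode b (-1 - j.+1%:Z) (voa_vac V).
    rewrite mode_D; congr (_ *: voa_mode _ _ _); last by lia.
    by rewrite -mulrNz (_ : - _ = j.+1%:Z) //; lia.
  by rewrite scalerA mulVf ?scale1r ?pnatr_eq0.
suff H (j : nat) b : voa_mode (D b) (-1 - j%:Z) (voa_vac V) \in Otilde V.
  by rewrite mode_vac rpredZ.
elim: j b => [|j IH] b; last by rewrite mode_vac rpredZ.
by rewrite subr0 voa_creation D_Otilde.
Qed.

(** Modulo [Otilde V], Y(u, x)v is Y(v, - x)u; the substitution x -> - x then changes phi(x) into -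
    phi(- x) = phi(x) - c. *)
Lemma bullet_comm u v :
  bullet u v - (bullet v u - c *: voa_mode v 0 u) \in Otilde V.
Proof.
pose N := (pole_order u v + pole_order v u).+2.
rewrite !bulletE !(@resE _ _ _ _ _ _ N) /N; [|lia..].
(* The constant c of the parity formula occupies the index 1 of x phi(x), which pairs with v_0. *)
have -> : c *: voa_mode v 0 u = \sum_(i < N) (c * (i == 1%N :> nat)%:R) *: voa_mode v (i%:Z - 1) u.
  rewrite /N !big_ord_recl big1 /= => [|i _]; last by rewrite mulr0 scale0r.
  by rewrite mulr0 scale0r add0r addr0 mulr1.
rewrite -sumrB -sumrB rpred_sum // => i _.
rewrite -scalerBl -(phix_parity (twopii_neq0 R)) (mulrC (_ ^+ _)) -[(phi i * _) *: _]scalerA -scalerBr rpredZ //.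
by have := skew_symmetry u v (i%:Z - 1); rewrite subrK.
Qed.

(* The Jacobi identity at [m = 0]. *)
Lemma jacobi_iterate u v w (l n : int) (M1 M2 : nat) :
    (forall i : nat, (M1 <= i)%N -> voa_mode v (n + i%:Z) w = 0) ->
    (forall i : nat, (M2 <= i)%N -> voa_mode u i w = 0) ->
  voa_mode (voa_mode u l v) n w =
    \sum_(i < M1) ((-1) ^+ i * binz K l i) *:
       voa_mode u (l - i%:Z) (voa_mode v (n + i%:Z) w)
    - \sum_(i < M2) ((-1) ^ l * (-1) ^+ i * binz K l i) *:
       voa_mode v (n + l - i%:Z) (voa_mode u i w).
Proof.
move=> H1 H2; have := @voa_jacobi R V u v w l 0 n.
rewrite (@fsum_nat _ _ M1) => [|i /H1 ->]; last by rewrite mode0r scaler0.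
rewrite (@fsum_nat _ _ M2) => [|i Mi]; last by rewrite add0r H2 // mode0r scaler0.
rewrite (@fsum_nat _ _ 1) => [|[|i] // _]; last by rewrite binz_0 scale0r.
rewrite big_ord1 binz0 scale1r !addr0 !add0r => <-.
by congr (_ - _); apply: eq_bigr => i _; rewrite add0r.
Qed.

(** Each (u_(s-1) v)_(t-1) w is expanded by [jacobi_iterate]. In its first sum, summing over s at
    fixed t gives residues against phi^(i); in the second, the modes of v only depend on s + t. *)
Lemma bullet_assoc u v w :
  bullet (bullet u v) w - bullet u (bullet v w) \in Otilde V.
Proof.
pose M1 := (pole_order v w).+1; pose M2 := pole_order u w.
(* [N1] and [N2] bound s and t in all the residues at once; [N2] comes second, since it covers the
   vectors u_(s-1) v for s < [N1]. *)
pose N1 := (pole_order u v + \max_(b < M1) pole_order u (voa_mode v (b%:Z - 1) w)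
  + \max_(i < M2) pole_order v (voa_mode u i w) + M1 + M2 + 2)%N.
pose N2 := (\max_(s < N1) pole_order (voa_mode u (s%:Z - 1) v) w
  + \max_(i < M2) pole_order v (voa_mode u i w) + M1 + M2 + 2)%N.
have leN1u (b : nat) : (b < M1)%N -> (pole_order u (voa_mode v (b%:Z - 1) w) + M1 <= N1)%N.
  move=> bM; have := @leq_bigmax _ (fun b : 'I_M1 => pole_order u (voa_mode v (b%:Z - 1) w)) (Ordinal bM).
  by rewrite /N1 /=; lia.
have leN1v (i : 'I_M2) : (pole_order v (voa_mode u i w) + i.+2 <= N1)%N.
  have := @leq_bigmax _ (fun i : 'I_M2 => pole_order v (voa_mode u i w)) i.
  by have := ltn_ord i; rewrite /N1 /=; lia.
have leN2v (i : 'I_M2) : (pole_order v (voa_mode u i w) + i.+2 <= N2)%N.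
  have := @leq_bigmax _ (fun i : 'I_M2 => pole_order v (voa_mode u i w)) i.
  by have := ltn_ord i; rewrite /N2 /=; lia.
have leN2 (s : 'I_N1) : (pole_order (voa_mode u (s%:Z - 1) v) w + 1 <= N2)%N.
  have := @leq_bigmax _ (fun s : 'I_N1 => pole_order (voa_mode u (s%:Z - 1) v) w) s.
  by rewrite /N2 /=; lia.
have vw0 (t i : nat) : (M1 <= t + i)%N -> voa_mode v (t%:Z - 1 + i%:Z) w = 0.
  by move=> le; apply: mode_pole_order; rewrite /M1 in le; lia.
have uw0 (i : nat) : (M2 <= i)%N -> voa_mode u i w = 0.
  by move=> le; apply: mode_pole_order; rewrite /M2 in le; lia.
pose y (t i : nat) := voa_mode v (t%:Z - 1 + i%:Z) w.
have resy (t : nat) (i : 'I_M1) :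
    \sum_(s < N1) dphix c i s *: voa_mode u (s%:Z - i.+1%:Z) (y t i)
    = res i.+1 (dphix c i) u (y t i).
  (* For t + i >= [M1] the vector [y t i] is zero, so [N1] only has to cover finitely many
     vectors. *)
  have [le|lt] := leqP M1 (t + i).
    by rewrite /y vw0 // res0 big1 // => s _; rewrite mode0r scaler0.
  rewrite (@resE _ _ _ _ _ _ N1) //; have := leN1u _ lt; rewrite /y.
  rewrite (_ : (t + i)%N%:Z - 1 = t%:Z - 1 + i%:Z); last by lia.
  by have := ltn_ord i; lia.
have E1 : bullet (bullet u v) w =
    \sum_(t < N2) \sum_(i < M1) (phi t * (-1) ^+ i) *: res i.+1 (dphix c i) u (y t i)
  - \sum_(i < M2) res i.+2 (dphix_opp c i * phi) v (voa_mode u i w).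
  rewrite [bullet u v]bulletE (@resE _ _ _ _ _ _ N1); last by rewrite /N1; lia.
  rewrite (linear_comb _ _ _ (@bullet_linear_l R V w)).
  transitivity (\sum_(s < N1) \sum_(t < N2)
     ((\sum_(i < M1) (phi t * (-1) ^+ i) *: (dphix c i s *: voa_mode u (s%:Z - i.+1%:Z) (y t i)))
      - \sum_(i < M2) (dphix_opp c i s * phi t) *: voa_mode v ((s + t)%N%:Z - i.+2%:Z) (voa_mode u i w))).
    apply: eq_bigr => s _; rewrite bulletE (@resE _ _ _ _ _ _ N2) //.
    rewrite scaler_sumr; apply: eq_bigr => t _; rewrite scalerA.
    rewrite (@jacobi_iterate _ _ _ _ _ M1 M2) //; last first.
      by move=> i Mi; apply: vw0; lia.
    rewrite scalerBr !scaler_sumr; congr (_ - _); apply: eq_bigr => i _.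
      rewrite !scalerA /dphix; congr (_ *: voa_mode _ _ _); [ring|lia].
    rewrite !scalerA /dphix_opp; congr (_ *: voa_mode _ _ _); [ring|lia].
  under eq_bigr => s _ do rewrite sumrB.
  rewrite sumrB; congr (_ - _).
    rewrite exchange_big; apply: eq_bigr => t _; rewrite exchange_big; apply: eq_bigr => i _.
    by rewrite -scaler_sumr resy.
  under eq_bigr => s _ do rewrite exchange_big.
  rewrite exchange_big; apply: eq_bigr => i _.
  rewrite (@psM_sum _ _ _ _ (fun r : nat => voa_mode v (r%:Z - i.+2%:Z) (voa_mode u i w))
    (pole_order v (voa_mode u i w) + i.+2)) //.
  by move=> r le; apply: mode_pole_order; lia.
have E2 : bullet u (bullet v w) = \sum_(t < N2) phi t *: res 1 phi u (y t 0%N).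
  rewrite [bullet v w]bulletE (@resE _ _ _ _ _ _ N2); last by rewrite /N2 /M1; lia.
  rewrite (linear_comb _ _ _ (@bullet_linear_r R V u)); apply: eq_bigr => t _.
  by rewrite bulletE /y addr0.
rewrite E1 E2 addrAC -sumrB rpredB // rpred_sum // => [t _|i _]; last first.
  by have [a ->] := nice_good (dphix_opp_nice (twopii_neq0 R) i) v; apply: D_bullet_Otilde.
(* The term i = 0, with kernel phi itself, is u . (v . w) and cancels. *)
rewrite /M1 big_ord_recl dphix0 expr0 mulr1 addrAC subrr add0r rpred_sum // => i _.
rewrite rpredZ // lift0.
by have [a ->] := nice_good (dphix_nice (twopii_neq0 R) i) u; apply: D_bullet_Otilde.
Qed.

Lemma D_mode0 u w : voa_mode (D u) 0 w = 0.
Proof. by rewrite mode_D oppr0 scale0r. Qed.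

Lemma Otilde_mull o w : o \in Otilde V -> bullet o w \in Otilde V.
Proof.
move: o; apply: Otilde_ind => [|k a b Oa Ob|u v].
- by rewrite (linear_at0 (@bullet_linear_l R V w)) rpred0.
- by rewrite bullet_linear_l rpredD ?rpredZ.
- rewrite -[X in X \in _](subrK (bullet (D u) (bullet v w))).
  by rewrite rpredD ?bullet_assoc ?D_bullet_Otilde.
Qed.

(** Associativity reduces the claim to w . (L(-1)u). As (L(-1)u)_0 = 0, this is congruent to
    (L(-1)u) . w, and [Otilde_mull] applies. *)
Lemma Otilde_mulr w o : o \in Otilde V -> bullet w o \in Otilde V.
Proof.
move: o; apply: Otilde_ind => [|k a b Oa Ob|u v].
- by rewrite (linear_at0 (@bullet_linear_r R V w)) rpred0.
- by rewrite bullet_linear_r rpredD ?rpredZ.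
- have -> : bullet w (bullet (D u) v) = bullet (bullet w (D u)) v
      - (bullet (bullet w (D u)) v - bullet w (bullet (D u) v)) by rewrite subKr.
  rewrite rpredB ?bullet_assoc // Otilde_mull //.
  have := bullet_comm w (D u); rewrite D_mode0 scaler0 subr0 => O.
  by rewrite -[bullet w _](subrK (bullet (D u) w)) rpredD ?D_bullet_Otilde.
Qed.

End ZhuAlgebra.

(** * The algebra structure on the quotient *)

Theorem proposition6p5 (R : realType) (V : VOA R) :
  (exists mul : Atilde V -> Atilde V -> Atilde V,
    [/\ forall u v : V, mul (Aclass u) (Aclass v) = Aclass (bullet u v),
        (forall a, linear (mul a)) /\ (forall b, linear (mul^~ b)),
        associative mul,
        left_id (Aclass (voa_vac V)) mul /\ right_id (Aclass (voa_vac V)) mul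
      & forall a, mul (Aclass (voa_omega V)) a = mul a (Aclass (voa_omega V))])
  /\ (forall u v : V, bullet (voa_L (-1) u) v \in Otilde V)
  /\ (forall u v : V,
        bullet u v - (bullet v u - twopii *: voa_mode v 0 u) \in Otilde V).
Proof.
have classP u v : Aclass u = Aclass v <-> u - v \in Otilde V by exact: lquot_eqP.
have reprK' a : Aclass (repr a) = a :> Atilde V by exact: reprK.
have class_lin k u v : Aclass (k *: u + v) = k *: Aclass u + Aclass v :> Atilde V.
  by rewrite /Aclass lquot_piD lquot_pi_scale.
pose mul (a b : Atilde V) : Atilde V := Aclass (bullet (repr a) (repr b)).
have mulE u v : mul (Aclass u) (Aclass v) = Aclass (bullet u v).
  (* Independence of the representatives, changing one factor at a time: the left factor by
     [Otilde_mull], the right one by [Otilde_mulr]. *)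
  apply/classP; rewrite -[X in X \in _](subrKA (bullet u (repr (Aclass v)))).
  have sub_repr x : repr (Aclass x) - x \in Otilde V by apply/classP; exact: reprK'.
  rewrite rpredD //.
    rewrite -scaleN1r addrC -bullet_linear_l scaleN1r addrC.
    exact: Otilde_mull.
  rewrite -scaleN1r addrC -bullet_linear_r scaleN1r addrC.
  exact: Otilde_mulr.
split; last by split=> u v; [exact: D_bullet_Otilde | exact: bullet_comm].
exists mul; split=> //.
- split=> [a k|b k]; elim/lquot_ind => u; elim/lquot_ind => v; rewrite -!/(Aclass _).
    by rewrite -(reprK' a) -class_lin !mulE bullet_linear_r class_lin.
  by rewrite -(reprK' b) -class_lin !mulE bullet_linear_l class_lin.
- move=> a b d; rewrite -(reprK' a) -(reprK' b) -(reprK' d) !mulE.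
  by apply/esym/classP/bullet_assoc.
- by split=> a; rewrite -(reprK' a) mulE ?bullet_vac_l ?bullet_vac_r.
- move=> a; rewrite -(reprK' a) !mulE; apply/esym/classP.
  (* The commutator is congruent to [- z], a multiple of omega_0 v = L(-1)v. *)
  pose v : V := repr a; pose z := twopii *: voa_mode (voa_omega V) 0 v.
  have -> : bullet v (voa_omega V) - bullet (voa_omega V) v =
      bullet v (voa_omega V) - (bullet (voa_omega V) v - z) - z.
    by rewrite opprB addrA addrAC addrK.
  by rewrite rpredB ?bullet_comm // rpredZ // (D_Otilde v).
Qed.
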